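(* Assume $n\ge2$, fix $\lambda\ge0$ and let $(p^t)_{t\ge0}$ be the iterates of the Blahut–Arimoto iteration started from the uniform distribution. Then for every $t\ge1$, $$0\le F(\lambda)-f_\lambda(p^{t+1},p^t)<\frac{\ln n}{t}.$$ Hence an accuracy $\varepsilon>0$ for $F(\lambda)$ is reached after at most $(\ln n)/\varepsilon$ iterations.
   Context: Setup: integers $n\ge 2$, $m\ge1$; density matrices $\rho_1,\dots,\rho_n\in\mathcal{D}^m$ ($m\times m$ complex positive semidefinite, trace one); $\Delta_n$ the probability simplex in $\mathbb{R}^n$; $s\in\mathbb{R}^n$, $s\ge0$; $\lambda\ge0$. All logarithms are natural; matrix logarithms of positive semidefinite matrices are taken on their support, convention $0\ln0=0$. For $p\in\Delta_n$, $\rho_p=\sum_xp_x\rho_x$. For $p,p'\in\Delta_n$, $$f_\lambda(p,p')=\sum_x p_x\ln\frac{p'_x}{p_x}+\sum_x p_x\operatorname{Tr}[\rho_x(\ln\rho_x-\ln\rho_{p'})]-\lambda s^Tp$$ (terms with $p_x=0$ are zero; value $-\infty$ if $p_x>0=p'_x$ for some $x$), and $F(\lambda)=\max_{p}\max_{p'}f_\lambda(p,p')$. Blahut–Arimoto iteration: $p^0_x=1/n$ for all $x$; given $p^t$ with positive entries, set $\rho^t=\rho_{p^t}$, $r^t_x=\exp\big(\ln p^t_x+\operatorname{Tr}[\rho_x\ln\rho_x]-\operatorname{Tr}[\rho_x\ln\rho^t]-\lambda s_x\big)$ and $p^{t+1}_x=r^t_x/\sum_yr^t_y$. *)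

(* Defs.v *)
From Stdlib Require Import Reals Lra ClassicalEpsilon.
Open Scope R_scope.

Record C := mkC { re : R; im : R }.
Definition C0 : C := mkC 0 0.
Definition C1 : C := mkC 1 0.
Definition RtoC (a : R) : C := mkC a 0.
Definition Cadd (z w : C) : C := mkC (re z + re w) (im z + im w).
Definition Copp (z : C) : C := mkC (- re z) (- im z).
Definition Cmul (z w : C) : C :=
  mkC (re z * re w - im z * im w) (re z * im w + im z * re w).
Definition Cconj (z : C) : C := mkC (re z) (- im z).
Definition Cscale (a : R) (z : C) : C := mkC (a * re z) (a * im z).

Fixpoint Csum (k : nat) (f : nat -> C) : C :=
  match k with O => C0 | S k' => Cadd (Csum k' f) (f k') end.
Fixpoint Rsum (k : nat) (f : nat -> R) : R :=
  match k with O => 0 | S k' => Rsum k' f + f k' end.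

(* ---------- matrices: entries (i,j) with i,j < m are relevant ---------- *)
Definition Mat := nat -> nat -> C.
Definition mmul (m : nat) (A B : Mat) : Mat :=
  fun i j => Csum m (fun k => Cmul (A i k) (B k j)).
Definition madj (A : Mat) : Mat := fun i j => Cconj (A j i).
Definition msub (A B : Mat) : Mat := fun i j => Cadd (A i j) (Copp (B i j)).
Definition mtrace (m : nat) (A : Mat) : C := Csum m (fun i => A i i).
Definition mdiag (mu : nat -> R) : Mat :=
  fun i j => if Nat.eq_dec i j then RtoC (mu i) else C0.
Definition mid : Mat := fun i j => if Nat.eq_dec i j then C1 else C0.
Definition meq (m : nat) (A B : Mat) : Prop :=
  forall i j, (i < m)%nat -> (j < m)%nat -> A i j = B i j.

Definition is_density (m : nat) (rho : Mat) : Prop :=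
  meq m rho (madj rho) /\
  (forall v : nat -> C,
      0 <= re (Csum m (fun i => Cmul (Cconj (v i))
                                   (Csum m (fun j => Cmul (rho i j) (v j)))))) /\
  mtrace m rho = C1.

Definition spectral (m : nat) (sigma : Mat) (mu : nat -> R) (V : Mat) : Prop :=
  meq m (mmul m (madj V) V) mid /\
  meq m sigma (mmul m (mmul m V (mdiag mu)) (madj V)).

Definition ln_supp (x : R) : R := if Rlt_dec 0 x then ln x else 0.

Definition mlog (m : nat) (sigma : Mat) : Mat :=
  let pr := epsilon (inhabits ((fun _ : nat => 0), (fun _ _ : nat => C0)))
              (fun pr : (nat -> R) * Mat => spectral m sigma (fst pr) (snd pr)) in
  mmul m (mmul m (snd pr) (mdiag (fun k => ln_supp (fst pr k)))) (madj (snd pr)).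

(* Tr[A B] (real part; real for Hermitian A, B) *)
Definition trRe (m : nat) (A B : Mat) : R := re (mtrace m (mmul m A B)).

Definition simplex (n : nat) (p : nat -> R) : Prop :=
  (forall x, (x < n)%nat -> 0 <= p x) /\ Rsum n p = 1.

Definition rho_mix (n : nat) (rho : nat -> Mat) (p : nat -> R) : Mat :=
  fun i j => Csum n (fun x => Cscale (p x) (rho x i j)).

(* f_lambda(p,p') ; None encodes -infinity *)
Definition f_lam (n m : nat) (rho : nat -> Mat) (s : nat -> R) (lam : R)
    (p p' : nat -> R) : option R :=
  if excluded_middle_informative
       (exists x, (x < n)%nat /\ 0 < p x /\ p' x = 0)
  then None
  else Some (Rsum n (fun x =>
                if Rlt_dec 0 (p x) then
                  p x * ln (p' x / p x)
                  + p x * trRe m (rho x) (msub (mlog m (rho x))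
                                              (mlog m (rho_mix n rho p')))
                else 0)
             - lam * Rsum n (fun x => s x * p x)).

Definition F_lam (n m : nat) (rho : nat -> Mat) (s : nat -> R) (lam : R) : R :=
  epsilon (inhabits 0) (fun M =>
    (exists p p', simplex n p /\ simplex n p' /\ f_lam n m rho s lam p p' = Some M) /\
    (forall p p' v, simplex n p -> simplex n p' ->
        f_lam n m rho s lam p p' = Some v -> v <= M)).

Definition BA_step (n m : nat) (rho : nat -> Mat) (s : nat -> R) (lam : R)
    (p : nat -> R) : nat -> R :=
  let rt := rho_mix n rho p in
  let r := fun x => exp (ln (p x) + trRe m (rho x) (mlog m (rho x))
                          - trRe m (rho x) (mlog m rt) - lam * s x) in
  fun x => r x / Rsum n r.

Fixpoint BA (n m : nat) (rho : nat -> Mat) (s : nat -> R) (lam : R) (t : nat)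
    : nat -> R :=
  match t with
  | O => fun _ => 1 / INR n
  | S t' => BA_step n m rho s lam (BA n m rho s lam t')
  end.

(* Main.v *)
(* Two properties of the quantum relative entropy drive the convergence rate.

   Joint convexity, in the form D(rho_p || rho_q) <= D(p || q). For spectral data
   a, b of A = rho_p, B = rho_q with overlaps w, the quantity
   sum w a^2 / (b + s a) is, for each s > 0, a maximum of functionals linear in
   (A, B); hence it is at most sum p^2 / (q + s p). Comparing the primitives in s
   on [0, S] and letting S go to infinity gives the inequality between the
   entropies. Klein's inequality gives D(rho_p || rho_q) >= 0.

   Write h(p) = f(p, p). The two properties give f(p, q) <= h(p) <= g(p, q), with
   g linear in p; so h is upper semicontinuous and the maximum F is attained, at
   some pi with F = h(pi). By Gibbs' inequality f(., p^t) is maximal at p^{t+1},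
   with value v_t = ln Z_t, so v_t is nondecreasing, and
     F - v_t <= sum_x pi_x (ln p^{t+1}_x - ln p^t_x).
   The right-hand side telescopes from the uniform distribution, so that
   (t + 1) (F - v_t) <= ln n. *)
Require Import Defs.
From Stdlib Require Import Reals Lra Lia Classical ClassicalEpsilon.
From mathcomp Require all_boot all_order all_algebra complex Rstruct ring lra.
Open Scope R_scope.

(** * Elementary inequalities for the logarithm *)

Lemma ln_quot (x y : R) : 0 < x -> 0 < y -> ln (x / y) = ln x - ln y.
Proof.
  intros hx hy. unfold Rdiv. rewrite ln_mult; [ | assumption | now apply Rinv_0_lt_compat].
  rewrite ln_Rinv; [ring | assumption].
Qed.

Lemma ln_mono (x y : R) : 0 < x -> x <= y -> ln x <= ln y.
Proof.
  intros hx [h | ->]; [left; now apply ln_increasing | right; reflexivity].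
Qed.

Lemma ln_le_pred (x : R) : 0 < x -> ln x <= x - 1.
Proof.
  intros hx. pose proof (exp_ineq1_le (ln x)) as h. rewrite exp_ln in h; lra.
Qed.

(** Tail estimate for large [S]: it makes the boundary term at infinity vanish when primitives are
    compared. *)
Lemma ln_shift_le (q S : R) : 0 < q -> 0 < S -> ln (q + S) - ln S <= q / S.
Proof.
  intros hq hS. rewrite <- ln_quot by lra.
  replace (q / S) with ((q + S) / S - 1) by (field; lra).
  apply ln_le_pred. apply Rdiv_lt_0_compat; lra.
Qed.

(** Scalar form of Klein's inequality, from [ln x <= x - 1] at [x = b / a]. The last hypothesis is
    the support condition: where [b] vanishes, [ln_supp] returns the default 0, and the weight
    [a * w] must vanish too. *)
Lemma ln_gap_ge (a b w : R) : 0 <= a -> 0 <= b -> 0 <= w -> (b = 0 -> a * w = 0) ->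
  (a - b) * w <= a * w * (ln_supp a - ln_supp b).
Proof.
  intros ha hb hw h. unfold ln_supp.
  destruct (Rlt_dec 0 a) as [pa | na]; destruct (Rlt_dec 0 b) as [pb | nb].
  - assert (hab : 0 < b / a) by now apply Rdiv_lt_0_compat.
    pose proof (ln_le_pred _ hab) as L. rewrite ln_quot in L by assumption.
    assert (Q : a * (1 + (ln b - ln a)) <= b).
    { replace b with (a * (b / a)) at 2 by (field; lra). apply Rmult_le_compat_l; lra. }
    nra.
  - assert (b = 0) by lra. rewrite h by assumption. subst b.
    rewrite Rminus_0_r, h by reflexivity. lra.
  - assert (a = 0) by lra. subst a. nra.
  - assert (a = 0) by lra. assert (b = 0) by lra. subst. lra.
Qed.

Lemma derivable_pt_lim_ln_shift (A r s : R) : 0 < r + s ->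
  derivable_pt_lim (fun t => A * ln (r + t)) s (A / (r + s)).
Proof.
  intros h. apply (derivable_pt_lim_scal (fun t => ln (r + t))).
  rewrite <- (Rmult_1_r (/ (r + s))).
  apply (derivable_pt_lim_comp (fun t => r + t) ln).
  - rewrite <- (Rplus_0_l 1) at 1.
    apply (derivable_pt_lim_plus (fct_cte r) id);
      [apply derivable_pt_lim_const | apply derivable_pt_lim_id].
  - now apply derivable_pt_lim_ln.
Qed.

(** * Quantum relative entropy of mixtures *)

Module Quantum.
Import all_boot all_order all_algebra complex Rstruct ring lra.
Import Order.TTheory GRing.Theory Num.Theory.
Set Implicit Arguments. Unset Strict Implicit. Unset Printing Implicit Defensive.
Local Open Scope ring_scope.
Local Open Scope sesquilinear_scope.
Local Notation RR := Rdefinitions.R.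
Local Notation CC := (complex RR).
Local Notation Re := complex.Re.
Local Notation Im := complex.Im.

(** * Translation of the concrete matrices into complex matrices of MathComp *)

Definition toC (z : Defs.C) : CC := Complex (re z) (im z).
Definition toM m (A : Mat) : 'M[CC]_m := \matrix_(i, j) toC (A i j).

Lemma RsumE n f : Rsum n f = \sum_(i < n) f i.
Proof. by elim: n => [|n IH] /=; rewrite ?big_ord0 // big_ord_recr /= IH. Qed.

Lemma toC_sum n f : toC (Csum n f) = \sum_(i < n) toC (f i).
Proof.
elim: n => [|n IH] /=; rewrite ?big_ord0 // big_ord_recr /= -IH.
by case: (Csum n f) => ? ?; case: (f n).
Qed.

Lemma toC_mul z w : toC (Cmul z w) = toC z * toC w.
Proof. by case: z w => ? ? [? ?]. Qed.

Lemma toC_conj z : toC (Cconj z) = (toC z)^*.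
Proof. by case: z. Qed.

Lemma toC_inj : injective toC.
Proof. by case=> ? ? [? ?] [-> ->]. Qed.

Lemma toM_mul m A B : toM m (mmul m A B) = toM m A *m toM m B.
Proof.
apply/matrixP=> i j; rewrite !mxE toC_sum; apply: eq_bigr => k _.
by rewrite toC_mul !mxE.
Qed.

Lemma toM_adj m A : toM m (madj A) = (toM m A)^t*.
Proof. by apply/matrixP=> i j; rewrite !mxE toC_conj. Qed.

Lemma toM_sub m A B : toM m (msub A B) = toM m A - toM m B.
Proof. by apply/matrixP=> i j; rewrite !mxE. Qed.

Definition rdiag m (x : nat -> RR) : 'M[CC]_m := diag_mx (\row_i (x i)%:C%C).

Lemma ordE m (i j : 'I_m) : (if Nat.eq_dec i j then true else false) = (i == j).
Proof.
case: Nat.eq_dec => e; last by apply/esym/eqP => E; case: e; rewrite E.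
by apply/esym/eqP/val_inj.
Qed.

Lemma toM_diag m x : toM m (mdiag x) = rdiag m x.
Proof.
apply/matrixP=> i j; rewrite !mxE /mdiag -ordE.
by case: Nat.eq_dec => e.
Qed.

Lemma toM_id m : toM m mid = 1%:M.
Proof.
apply/matrixP=> i j; rewrite !mxE /mid -ordE.
by case: Nat.eq_dec => e.
Qed.

Lemma meqE m A B : meq m A B <-> toM m A = toM m B.
Proof.
split=> [E|/matrixP E i j /ssrnat.ltP li /ssrnat.ltP lj].
  by apply/matrixP=> i j; rewrite !mxE E //; apply/ssrnat.ltP.
by have := E (Ordinal li) (Ordinal lj); rewrite !mxE => /toC_inj.
Qed.

Lemma trRe_toM m A B : trRe m A B = Re (\tr (toM m A *m toM m B)).
Proof.
rewrite -toM_mul /trRe /mtrace /mxtrace.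
under eq_bigr do rewrite mxE.
by rewrite -(toC_sum m (fun i => mmul m A B i i)).
Qed.

Lemma Re_sum (I : Type) (r : seq I) (P : pred I) (F : I -> CC) :
  Re (\sum_(i <- r | P i) F i) = \sum_(i <- r | P i) Re (F i).
Proof. by apply: (big_morph (@complex.Re RR)) => // [[? ?]] [? ?]. Qed.

Lemma Re_scale (a : RR) (z : CC) : Re (a%:C%C * z) = a * Re z.
Proof. by case: z => x y /=; rewrite mul0r subr0. Qed.

(** The spectral theorem for hermitian matrices, carried back to the concrete encoding; it ensures
    that the choice made in [mlog] is a genuine diagonalisation. *)
Lemma spectral_existence m rho : (toM m rho)^t* = toM m rho ->
  exists mu V, spectral m rho mu V.
Proof.
move=> H.
have hH : toM m rho \is hermsymmx.
  by apply/is_hermitianmxP; rewrite expr0 scale1r H.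
have := hermitian_normalmx hH => /orthomx_spectralP E.
have /mxOverP dR := hermitian_spectral_diag_real hH.
pose d := spectral_diag (toM m rho); pose U := spectralmx (toM m rho).
have Uu : U \is unitarymx by apply: spectral_unitarymx.
pose ofC (z : CC) : Defs.C := mkC (Re z) (Im z).
have ofCK z : toC (ofC z) = z by case: z.
pose mu k := if insub k is Some i then Re (d 0 i) else 0.
(* The diagonalisation reads [rho = U' D U] with [U'] the adjoint of [U], whereas [spectral] has the
   eigenvectors as columns on the left; hence the adjoint. Entries out of range are set to zero. *)
pose V : Mat := fun i j =>
  if (insub i, insub j) is (Some i', Some j') then ofC ((U^t*) i' j') else C0.
have EV : toM m V = U^t*.
  by apply/matrixP=> i j; rewrite mxE /V !valK ofCK.
have Emu : rdiag m mu = diag_mx d.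
  congr diag_mx; apply/rowP=> i; rewrite mxE /mu valK.
  by rewrite RRe_real.
exists mu, V; split; apply/meqE.
  by rewrite toM_mul toM_adj EV trmxCK toM_id; apply/unitarymxP.
rewrite !toM_mul toM_adj EV trmxCK toM_diag Emu -invmx_unitary //.
Qed.

(** * From inequalities between resolvent sums to inequalities between logarithms *)

Lemma derivable_pt_lim_bigsum (I : Type) (r : seq I) (f : I -> RR -> RR) (f' : I -> RR) s :
  (forall i, derivable_pt_lim (f i) s (f' i)) ->
  derivable_pt_lim (fun t => \sum_(i <- r) f i t) s (\sum_(i <- r) f' i).
Proof.
move=> df; elim: r => [|i r IH].
  rewrite big_nil; apply: (derivable_pt_lim_ext (fun _ => R0)).
    by move=> t; rewrite big_nil.
  exact: derivable_pt_lim_const.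
rewrite big_cons.
apply: (derivable_pt_lim_ext (fun t => f i t + \sum_(j <- r) f j t)).
  by move=> t; rewrite big_cons.
exact: derivable_pt_lim_plus.
Qed.

(** The difference [G] of the two shifted log-averages has derivative [G'], which is nonnegative on
    positive arguments by the resolvent hypothesis. So [G 0 <= G S], and [G S] is at most [K / S],
    which tends to 0. *)
Lemma ln_average_le (I J : finType) (A r : I -> RR) (P q : J -> RR) :
  (forall i, 0 <= A i) -> (forall j, 0 <= P j) ->
  (forall i, 0 < r i) -> (forall j, 0 < q j) ->
  \sum_i A i = 1 -> \sum_j P j = 1 ->
  (forall s, 0 < s -> \sum_i A i / (r i + s) <= \sum_j P j / (q j + s)) ->
  \sum_j P j * ln (q j) <= \sum_i A i * ln (r i).
Proof.
move=> A0 P0 r0 q0 A1 P1 H.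
pose G t := \sum_j P j * ln (q j + t)%R - \sum_i A i * ln (r i + t)%R.
pose G' t := \sum_j P j / (q j + t) - \sum_i A i / (r i + t).
have dG t : 0 <= t -> derivable_pt_lim G t (G' t).
  move=> t0; apply: derivable_pt_lim_minus; apply: derivable_pt_lim_bigsum => i;
  apply: derivable_pt_lim_ln_shift; apply/RltP; exact: ltr_wpDr.
pose K := \sum_j P j * q j.
have K0 : 0 <= K by apply: sumr_ge0 => j _; rewrite mulr_ge0 // ltW.
have GS S : 0 < S -> G 0 <= K / S.
  move=> S0; apply: (@le_trans _ _ (G S)).
    have /RltP S0' := S0.
    have [|c [E [/RltP c0 _]]] := MVT_cor2 G G' _ _ S0'.
      by move=> c [/RleP c0 _]; apply: dG.
    move: E; rewrite !RealsE subr0 => E.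
    rewrite -subr_ge0 E mulr_ge0 ?(ltW S0) // subr_ge0; exact: H.
  (* Both families of weights have total mass 1, so the two copies of [ln S] introduced here and in
     [hP] cancel in [G S]. *)
  have hA : ln S <= \sum_i A i * ln (r i + S)%R.
    rewrite -[X in X <= _]mul1r -A1 mulr_suml; apply: ler_sum => i _.
    apply: ler_wpM2l => //; apply/RleP/ln_mono; first by apply/RltP.
    by apply/RleP; rewrite lerDr ltW.
  have hP : \sum_j P j * ln (q j + S)%R - ln S <= K / S.
    rewrite -[X in _ - X]mul1r -P1 !mulr_suml -sumrB; apply: ler_sum => j _.
    rewrite -mulrBr -mulrA; apply: ler_wpM2l => //.
    by apply/RleP; apply: ln_shift_le; apply/RltP.
  rewrite /G; lra.
suff : G 0 <= 0.
  rewrite /G subr_le0.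
  by under eq_bigr do rewrite addr0; under [in X in _ <= X]eq_bigr do rewrite addr0.
rewrite leNgt; apply/negP => G0.
have K1 : 0 < K + 1 by lra.
(* With this [S] the bound reads [G 0 <= G 0 * K / (K + 1)], impossible for positive [G 0]. *)
have := GS ((K + 1) / G 0) (divr_gt0 K1 G0).
rewrite invf_div mulrA ler_pdivlMr // mulrC; nra.
Qed.

(** * Positive matrices, eigenbases and their overlaps *)

Section SpectralOverlap.
Variable m : nat.
Implicit Types (A B Z U V W : 'M[CC]_m).

(** Positivity is tested on matrices instead of vectors: the trace is the sum of the quadratic form
    over the columns of [Z], and the trace functionals below take matrix arguments. *)
Definition psd A := A^t* = A /\ forall Z, 0 <= Re (\tr (Z^t* *m A *m Z)).

Lemma adj_mul A B : (A *m B)^t* = B^t* *m A^t*.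
Proof. by rewrite trmx_mul map_mxM. Qed.

Lemma Re_conj (z : CC) : Re z^* = Re z.
Proof. by case: z. Qed.

Lemma Re_tr_adj A : Re (\tr (A^t*)) = Re (\tr A).
Proof. by rewrite trace_map_mx mxtrace_tr Re_conj. Qed.

Lemma adj_scalar (t : RR) : (t%:C%C%:M : 'M[CC]_m)^t* = t%:C%C%:M.
Proof.
by rewrite tr_scalar_mx map_scalar_mx; congr (_%:M); exact: conjc_real.
Qed.

Lemma ReD (x y : CC) : Re (x + y) = Re x + Re y. Proof. by case: x y => ? ? []. Qed.
Lemma ReN (x : CC) : Re (- x) = - Re x. Proof. by case: x. Qed.

Lemma Re_trB A B : Re (\tr (A - B)) = Re (\tr A) - Re (\tr B).
Proof. by rewrite linearB ReD ReN. Qed.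

Lemma Re_trZ (t : RR) A : Re (\tr (t%:C%C *: A)) = t * Re (\tr A).
Proof. by rewrite mxtraceZ Re_scale. Qed.

(** Positivity of [A] tested on [Z - t], expanded with [tr A = 1]. This is the Cauchy-Schwarz
    inequality in linearised form, with [t] left free to be optimised. *)
Lemma psd_trace_lb A Z (t : RR) : psd A -> Re (\tr A) = 1 ->
  2 * t * Re (\tr (Z^t* *m A)) - t ^+ 2 <= Re (\tr (Z^t* *m A *m Z)).
Proof.
case=> hA /(_ (Z - t%:C%C%:M)) + A1.
have expand P Q S B : Re (\tr (P - t%:C%C *: Q - (t%:C%C *: S - t%:C%C *: (t%:C%C *: B)))) =
    Re (\tr P) - t * Re (\tr Q) - (t * Re (\tr S) - t * (t * Re (\tr B))).
  by rewrite !Re_trB !Re_trZ.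
have -> : (Z - t%:C%C%:M)^t* = Z^t* - t%:C%C%:M.
  by rewrite linearB map_mxB /= adj_scalar.
rewrite mulmxBl mulmxBr !mulmxBl !mul_scalar_mx !mul_mx_scalar -!scalemxAl.
rewrite expand A1.
have -> : Re (\tr (A *m Z)) = Re (\tr (Z^t* *m A)).
  by rewrite -Re_tr_adj adj_mul hA.
lra.
Qed.

(** The test functional evaluated at a single state with weights [p], [p']. The previous bound is
    used for [Z] and for its adjoint with a common [t]. *)
Lemma psd_test_le A Z (p p' s : RR) : psd A -> Re (\tr A) = 1 ->
  0 <= p -> 0 <= p' -> 0 < s ->
  2 * p * Re (\tr (Z^t* *m A)) - p' * Re (\tr (Z^t* *m A *m Z))
    - s * p * Re (\tr (Z *m A *m Z^t*)) <= p ^+ 2 / (p' + s * p).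
Proof.
move=> hA A1 p0 p'0 s0.
have sp0 : 0 <= s * p by rewrite mulr_ge0 // ltW.
set D := p' + s * p; have D0 : 0 <= D by rewrite addr_ge0.
(* If [D = 0] then [p = p' = 0], and both sides are 0. *)
have [DE|Dn] := eqVneq D 0.
  have pE : p = 0.
    apply/eqP; have := paddr_eq0 p'0 sp0.
    by rewrite -/D DE eqxx => /esym/andP[_]; rewrite mulf_eq0 gt_eqF.
  have p'E : p' = 0 by move: DE; rewrite /D pE mulr0 addr0.
  by rewrite DE pE p'E invr0; lra.
(* The choice [t * D = p] cancels the terms in [u], leaving a bound independent of [Z]. *)
pose t := p / D.
have h1 := psd_trace_lb Z t hA A1.
have := psd_trace_lb (Z^t*) t hA A1.
rewrite trmxCK.
have -> : Re (\tr (Z *m A)) = Re (\tr (Z^t* *m A)).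
  by rewrite -Re_tr_adj adj_mul hA.1 mxtrace_mulC.
move=> h2.
set u := Re (\tr (Z^t* *m A)) in h1 h2 *.
have tD : t * D = p by rewrite /t divfK.
have -> : p ^+ 2 / D = p * t by rewrite /t; ring.
have h3 := ler_wpM2l p'0 h1.
have h4 := ler_wpM2l sp0 h2.
suff E : 2 * p * u - (p' * (2 * t * u - t ^+ 2) + s * p * (2 * t * u - t ^+ 2)) = p * t by lra.
rewrite -mulrDl -/D.
have -> : D * (2 * t * u - t ^+ 2) = 2 * (t * D) * u - t * (t * D) by ring.
rewrite tD; ring.
Qed.

Definition sqmod (z : CC) : RR := Re z ^+ 2 + Im z ^+ 2.
(** Seen between two eigenbases, the optimal test matrix of the resolvent bound is the overlap
    matrix rescaled entrywise by real coefficients. *)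
Definition hadamard (c : 'I_m -> 'I_m -> RR) W : 'M[CC]_m :=
  \matrix_(j, i) ((c j i)%:C%C * W j i).

Lemma sqmod_ge0 z : 0 <= sqmod z.
Proof. by rewrite addr_ge0 // sqr_ge0. Qed.

Lemma hadamard1 W : hadamard (fun _ _ => 1) W = W.
Proof. by apply/matrixP=> i j; rewrite !mxE mul1r. Qed.

(** Common computation behind the trace formulas below: in eigenbases, they become double sums
    weighted by the squared moduli of the overlaps. *)
Lemma tr_hadamard W c d (x y : nat -> RR) :
  Re (\tr ((hadamard c W)^t* *m rdiag m y *m hadamard d W *m rdiag m x)) =
  \sum_i \sum_j c j i * d j i * y j * x i * sqmod (W j i).
Proof.
rewrite /mxtrace Re_sum; apply: eq_bigr => i _.
rewrite mul_mx_diag mxE mxE mulr_suml Re_sum; apply: eq_bigr => j _.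
rewrite mul_mx_diag !mxE /sqmod.
case: (W j i) => a b /=; rewrite !RealsE; ring.
Qed.

Definition eigdec A (a : nat -> RR) U :=
  U^t* *m U = 1%:M /\ A = U *m rdiag m a *m U^t*.

Lemma eigdec_unit A a U : eigdec A a U -> U *m U^t* = 1%:M.
Proof. by case=> /mulmx1C. Qed.

Lemma unitary_sqmod_row W : W^t* *m W = 1%:M -> forall i, \sum_j sqmod (W j i) = 1.
Proof.
move=> /matrixP h i; have /(congr1 (@complex.Re RR)) := h i i.
rewrite !mxE eqxx Re_sum /= => <-; apply: eq_bigr => j _.
by rewrite !mxE /sqmod; case: (W j i) => a b /=; rewrite ?RealsE; ring.
Qed.

Lemma unitary_sqmod_col W : W *m W^t* = 1%:M -> forall j, \sum_i sqmod (W j i) = 1.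
Proof.
move=> h j; rewrite -(@unitary_sqmod_row (W^t*) _ j) ?trmxCK //.
by apply: eq_bigr => i _; rewrite !mxE /sqmod; case: (W j i) => a b /=; rewrite ?RealsE; ring.
Qed.

Lemma sqmod_adj W i j : sqmod (W^t* i j) = sqmod (W j i).
Proof. by rewrite !mxE /sqmod; case: (W j i) => a b /=; rewrite ?RealsE; ring. Qed.

Lemma rdiag1 : rdiag m (fun=> 1) = 1%:M.
Proof. by apply/matrixP=> k l; rewrite !mxE. Qed.

Lemma eigdec_form A a U Z : eigdec A a U ->
  Re (\tr (Z^t* *m A *m Z)) = \sum_(k < m) \sum_(i < m) a i * sqmod ((U^t* *m Z) i k).
Proof.
case=> UU E; set X := U^t* *m Z; pose one := fun _ _ : 'I_m => 1 : RR.
have -> : Z^t* *m A *m Z =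
    (hadamard one X)^t* *m rdiag m a *m hadamard one X *m rdiag m (fun=> 1).
  by rewrite !hadamard1 rdiag1 mulmx1 E /X adj_mul trmxCK !mulmxA.
rewrite tr_hadamard; apply: eq_bigr => k _; apply: eq_bigr => i _.
by rewrite /one !(mulr1, mul1r).
Qed.

(** Multiplication by [delta_mx j j] keeps only column [j] of [V], so the trace is the quadratic
    form of [A] at that column, expanded in the eigenbasis of [A]. *)
Lemma eigdec_form_col A a U V j : eigdec A a U ->
  Re (\tr ((V *m delta_mx j j)^t* *m A *m (V *m delta_mx j j))) =
  \sum_(i < m) a i * sqmod ((V^t* *m U) j i).
Proof.
move=> H; rewrite (eigdec_form _ H) (bigD1 j) //= [X in _ + X]big1 ?addr0; last first.
  move=> k kj; rewrite big1 // => i _; rewrite mulmxA !mxE big1 ?[sqmod _]addr0.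
    by rewrite /sqmod /= ?RealsE !expr2 !mulr0 addr0 mulr0.
  by move=> l _; rewrite [delta_mx _ _ _ _]mxE (negbTE kj) andbF mulr0.
apply: eq_bigr => i _; congr (_ * _).
rewrite -(sqmod_adj (V^t* *m U)) adj_mul trmxCK mulmxA.
congr sqmod; rewrite mxE (bigD1 j) //= big1 ?addr0.
  by rewrite [delta_mx _ _ _ _]mxE !eqxx mulr1.
by move=> l lj; rewrite [delta_mx _ _ _ _]mxE (negbTE lj) mulr0.
Qed.

(** Positivity tested on the [i]-th eigenvector isolates [a i]. *)
Lemma eigdec_ge0 A a U : psd A -> eigdec A a U -> forall i : 'I_m, 0 <= a i.
Proof.
case=> _ P H i; have := P (U *m delta_mx i i).
rewrite (eigdec_form_col _ _ H) H.1 (bigD1 i) //= [X in _ + X]big1 ?addr0.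
  by rewrite mxE eqxx /sqmod /= ?RealsE !expr2 mulr0 mulr1 addr0 mulr1.
by move=> j ji; rewrite mxE eq_sym (negbTE ji) /sqmod /= ?RealsE !expr2 !mulr0 addr0 mulr0.
Qed.

Lemma eigdec_cross_trace A a U V (l : nat -> RR) : eigdec A a U ->
  Re (\tr (A *m (V *m rdiag m l *m V^t*))) =
  \sum_(i < m) \sum_(j < m) a i * l j * sqmod ((V^t* *m U) j i).
Proof.
case=> _ E; set W := V^t* *m U; pose one := fun _ _ : 'I_m => 1 : RR.
have -> : \tr (A *m (V *m rdiag m l *m V^t*)) =
    \tr ((hadamard one W)^t* *m rdiag m l *m hadamard one W *m rdiag m a).
  rewrite !hadamard1 /W adj_mul trmxCK.
  have -> : A *m (V *m rdiag m l *m V^t*) =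
      (U *m rdiag m a) *m (U^t* *m V *m rdiag m l *m V^t*) by rewrite E !mulmxA.
  by rewrite mxtrace_mulC !mulmxA.
rewrite tr_hadamard; apply: eq_bigr => i _; apply: eq_bigr => j _.
by rewrite /one !mul1r [l j * _]mulrC.
Qed.

Lemma eigdec_self_trace A a U (l : nat -> RR) : eigdec A a U ->
  Re (\tr (A *m (U *m rdiag m l *m U^t*))) = \sum_(i < m) a i * l i.
Proof.
move=> H; rewrite (eigdec_cross_trace _ _ H) H.1; apply: eq_bigr => i _.
rewrite (bigD1 i) //= [X in _ + X]big1 ?addr0.
  by rewrite mxE eqxx /sqmod /= ?RealsE !expr2 mulr0 mulr1 addr0 mulr1.
by move=> j ji; rewrite mxE (negbTE ji) /sqmod /= ?RealsE !expr2 !mulr0 addr0 mulr0.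
Qed.

Lemma eigdec_trace A a U : eigdec A a U -> Re (\tr A) = \sum_(i < m) a i.
Proof.
move=> H; have := eigdec_self_trace (fun=> 1) H.
rewrite rdiag1 mulmx1 (eigdec_unit H) mulmx1 => ->.
by apply: eq_bigr => i _; rewrite mulr1.
Qed.

Lemma Re_tr_mix n (p : 'I_n -> RR) (A : 'I_n -> 'M[CC]_m) (X Y : 'M[CC]_m) :
  Re (\tr (X *m (\sum_x (p x)%:C%C *: A x) *m Y)) =
  \sum_x p x * Re (\tr (X *m A x *m Y)).
Proof.
have trD : {morph (fun M : 'M[CC]_m => Re (\tr M)) : M N / M + N >-> M + N}.
  by move=> M N; rewrite mxtraceD ReD.
rewrite mulmx_sumr mulmx_suml (big_morph _ trD (congr1 (@complex.Re RR) (mxtrace0 _ _))).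
apply: eq_bigr => x _.
by rewrite -scalemxAr -scalemxAl Re_trZ.
Qed.

Lemma sum_lin3 (I : finType) (f g h : I -> RR) (s : RR) :
  2 * \sum_i f i - \sum_i g i - s * \sum_i h i = \sum_i (2 * f i - g i - s * h i).
Proof. by rewrite !mulr_sumr -!sumrB. Qed.

(* The left-hand side is the maximum over [Z] of
   [2 Re tr(Z' A) - tr(Z' B Z) - s tr(Z A Z')] with [Z'] the adjoint of [Z];
   the bound follows because this functional is linear in the pair [A, B]. *)
Lemma resolvent_mix_le n (p p' : 'I_n -> RR) (Ax : 'I_n -> 'M[CC]_m) A B a b U V (s : RR) :
  (forall x, psd (Ax x)) -> (forall x, Re (\tr (Ax x)) = 1) ->
  (forall x, 0 <= p x) -> (forall x, 0 <= p' x) ->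
  A = \sum_x (p x)%:C%C *: Ax x -> B = \sum_x (p' x)%:C%C *: Ax x ->
  psd A -> psd B -> eigdec A a U -> eigdec B b V -> 0 < s ->
  \sum_(i < m) \sum_(j < m) sqmod ((V^t* *m U) j i) * (a i ^+ 2 / (b j + s * a i))
  <= \sum_x p x ^+ 2 / (p' x + s * p x).
Proof.
move=> hpsd htr p0 p'0 EA EB psdA psdB dA dB s0.
have [W WE] : exists W, W = V^t* *m U by exists (V^t* *m U).
rewrite -WE.
(* In the two eigenbases the functional is, entry by entry, the quadratic [2 c a - c^2 (b + s a)]
   times the overlap; this is its maximiser. *)
pose c (j i : 'I_m) : RR := a i / (b j + s * a i).
pose one := fun _ _ : 'I_m => 1 : RR.
have [T TE] : exists T, T = hadamard c W by exists (hadamard c W).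
have [Z ZE] : exists Z, Z = V *m T *m U^t* by exists (V *m T *m U^t*).
have Zadj : Z^t* = U *m T^t* *m V^t* by rewrite ZE !adj_mul trmxCK mulmxA.
have [UU AE] := dA; have [VV BE] := dB.
have E1 : Re (\tr (Z^t* *m A *m 1%:M)) =
    \sum_(i < m) \sum_(j < m) c j i * a i * sqmod (W j i).
  have -> : \tr (Z^t* *m A *m 1%:M) =
      \tr (T^t* *m rdiag m (fun=> 1) *m hadamard one W *m rdiag m a).
    have -> : Z^t* *m A *m 1%:M = U *m (T^t* *m W *m rdiag m a *m U^t*).
      by rewrite mulmx1 Zadj AE WE !mulmxA.
    by rewrite mxtrace_mulC hadamard1 rdiag1 mulmx1 -(mulmxA _ (U^t*) U) UU mulmx1.
  rewrite TE tr_hadamard; apply: eq_bigr => i _; apply: eq_bigr => j _.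
  by rewrite /one !mulr1.
have E2 : Re (\tr (Z^t* *m B *m Z)) =
    \sum_(i < m) \sum_(j < m) c j i ^+ 2 * b j * sqmod (W j i).
  have -> : \tr (Z^t* *m B *m Z) =
      \tr (T^t* *m rdiag m b *m T *m rdiag m (fun=> 1)).
    have -> : Z^t* *m B *m Z = U *m (T^t* *m (V^t* *m V) *m rdiag m b *m (V^t* *m V) *m T *m U^t*).
      by rewrite Zadj BE ZE !mulmxA.
    by rewrite mxtrace_mulC VV rdiag1 !mulmx1 -(mulmxA _ (U^t*) U) UU mulmx1.
  rewrite TE tr_hadamard; apply: eq_bigr => i _; apply: eq_bigr => j _.
  by rewrite mulr1 expr2.
have E3 : Re (\tr (Z *m A *m Z^t*)) =
    \sum_(i < m) \sum_(j < m) c j i ^+ 2 * a i * sqmod (W j i).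
  have -> : \tr (Z *m A *m Z^t*) =
      \tr (T^t* *m rdiag m (fun=> 1) *m T *m rdiag m a).
    have -> : Z *m A *m Z^t* = V *m T *m (U^t* *m U) *m rdiag m a *m (U^t* *m U) *m (T^t* *m V^t*).
      by rewrite Zadj AE ZE !mulmxA.
    rewrite UU !mulmx1 mxtrace_mulC rdiag1 mulmx1.
    have -> : T^t* *m V^t* *m (V *m T *m rdiag m a) = T^t* *m (V^t* *m V) *m T *m rdiag m a.
      by rewrite !mulmxA.
    by rewrite VV mulmx1.
  rewrite TE tr_hadamard; apply: eq_bigr => i _; apply: eq_bigr => j _.
  by rewrite mulr1 expr2.
(* At this [Z] the functional attains the left-hand side. If a denominator vanishes, then so does
   [a i], and both sides are 0. *)
have L : \sum_(i < m) \sum_(j < m) sqmod (W j i) * (a i ^+ 2 / (b j + s * a i)) =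
   2 * Re (\tr (Z^t* *m A *m 1%:M)) - Re (\tr (Z^t* *m B *m Z))
     - s * Re (\tr (Z *m A *m Z^t*)).
  rewrite E1 E2 E3 sum_lin3; apply: eq_bigr => i _.
  rewrite sum_lin3; apply: eq_bigr => j _.
  have a0 := eigdec_ge0 psdA dA i; have b0 := eigdec_ge0 psdB dB j.
  have sa0 : 0 <= s * a i by rewrite mulr_ge0 // ltW.
  rewrite /c; set D := b j + s * a i.
  have [DE|Dn] := eqVneq D 0.
    have /eqP aE : a i == 0.
      have := paddr_eq0 b0 sa0; rewrite -/D DE eqxx => /esym/andP[_].
      by rewrite mulf_eq0 gt_eqF.
    by rewrite DE aE invr0; ring.
  rewrite /D in Dn *; field; exact: Dn.
rewrite L EA EB.
rewrite (Re_tr_mix p Ax (Z^t*) 1%:M) (Re_tr_mix p' Ax (Z^t*) Z) (Re_tr_mix p Ax Z (Z^t*)).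
rewrite sum_lin3; apply: ler_sum => x _.
rewrite mulmx1; have := psd_test_le Z (hpsd x) (htr x) (p0 x) (p'0 x) s0.
move: (Re _) (Re _) (Re _) => u1 u2 u3.
by rewrite !mulrA.
Qed.

(** * Relative entropy of two mixtures of the same states *)

Section RelativeEntropy.
Variables (n : nat) (p p' : 'I_n -> RR) (Ax : 'I_n -> 'M[CC]_m).
Variables (A B U V : 'M[CC]_m) (a b : nat -> RR).
Hypothesis Ax_psd : forall x, psd (Ax x).
Hypothesis Ax_tr : forall x, Re (\tr (Ax x)) = 1.
Hypothesis p_ge0 : forall x, 0 <= p x.
Hypothesis p'_ge0 : forall x, 0 <= p' x.
Hypothesis p_supp : forall x, 0 < p x -> 0 < p' x.
Hypothesis AE : A = \sum_x (p x)%:C%C *: Ax x.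
Hypothesis BE : B = \sum_x (p' x)%:C%C *: Ax x.
Hypothesis A_psd : psd A.
Hypothesis B_psd : psd B.
Hypothesis A_tr : Re (\tr A) = 1.
Hypothesis B_tr : Re (\tr B) = 1.
Hypothesis A_dec : eigdec A a U.
Hypothesis B_dec : eigdec B b V.

Let lna k := ln_supp (a k).
Let lnb k := ln_supp (b k).
(** Transition probabilities between the eigenbases of [A] and [B]; unitarity makes them doubly
    stochastic. *)
Let w (i j : 'I_m) := sqmod ((V^t* *m U) j i).
Let relent := Re (\tr (A *m (U *m rdiag m lna *m U^t*)))
              - Re (\tr (A *m (V *m rdiag m lnb *m V^t*))).

Lemma overlap_unitary : (V^t* *m U)^t* *m (V^t* *m U) = 1%:M.
Proof.
by rewrite adj_mul trmxCK mulmxA -(mulmxA (U^t*) V) (eigdec_unit B_dec) mulmx1; case: A_dec.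
Qed.

Lemma overlap_row i : \sum_j w i j = 1.
Proof. exact: unitary_sqmod_row overlap_unitary i. Qed.

Lemma overlap_col j : \sum_i w i j = 1.
Proof. apply: unitary_sqmod_col; exact: mulmx1C overlap_unitary. Qed.

Lemma relentE :
  relent = \sum_(i < m) \sum_(j < m) a i * w i j * (ln_supp (a i) - ln_supp (b j)).
Proof.
rewrite /relent (eigdec_self_trace _ A_dec) (eigdec_cross_trace _ _ A_dec) -sumrB.
apply: eq_bigr => i _.
(* The factor 1 is replaced by the row sum of [w], turning the single sum for [A] into a double
   sum. *)
rewrite -[X in X - _]mulr1 -(overlap_row i) mulr_sumr -sumrB; apply: eq_bigr => j _.
rewrite /lna /lnb -/(w i j); ring.
Qed.

(** The support of [A] lies in that of [B]: if [b j = 0], the quadratic form of [B] at the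
    eigenvector [j] vanishes, hence so does each term [p' x * q x], and by [p_supp] each
    [p x * q x]. The form of [A] there is thus 0, and it is a sum of nonnegative terms
    [a k * w k j]. *)
Lemma overlap_supp (i j : 'I_m) : b j = 0 -> a i * w i j = 0.
Proof.
move=> bj; pose Z := V *m delta_mx j j : 'M[CC]_m.
pose q x := Re (\tr (Z^t* *m Ax x *m Z)).
have q0 x : 0 <= q x by case: (Ax_psd x) => _; apply.
have qB : \sum_x p' x * q x = 0.
  rewrite -Re_tr_mix -BE (eigdec_form_col _ _ B_dec) B_dec.1 big1 // => k _.
  have [->|kj] := eqVneq k j; first by rewrite bj mul0r.
  by rewrite mxE eq_sym (negbTE kj) /sqmod /= ?RealsE !expr2 !mulr0 addr0 mulr0.
have qA : \sum_x p x * q x = 0.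
  rewrite big1 // => x _.
  have e0 : p' x * q x = 0.
    by apply: (psumr_eq0P _ qB) => // y _; rewrite mulr_ge0.
  move/eqP: e0; rewrite mulf_eq0 => /orP[/eqP e|/eqP ->]; last by rewrite mulr0.
  have := @p_supp x; rewrite e ltxx; have := p_ge0 x; rewrite le_eqVlt.
  by case/orP=> [/eqP <- _|h /(_ h)//]; rewrite mul0r.
move: qA; rewrite -Re_tr_mix -AE (eigdec_form_col _ _ A_dec) => qA.
have pos (k : 'I_m) : true -> 0 <= a k * sqmod ((V^t* *m U) j k).
  by move=> _; rewrite mulr_ge0 ?sqmod_ge0 // (eigdec_ge0 A_psd A_dec).
exact: (psumr_eq0P pos qA).
Qed.

(** Klein's inequality: the scalar bound is summed against the overlaps, and the linear terms cancel
    because [w] is doubly stochastic and both traces are 1. *)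
Lemma relent_ge0 : 0 <= relent.
Proof.
rewrite relentE.
have h (i j : 'I_m) : (a i - b j) * w i j <= a i * w i j * (ln_supp (a i) - ln_supp (b j)).
  apply/RleP; apply: ln_gap_ge; try apply/RleP; last exact: overlap_supp.
  - exact: eigdec_ge0 A_psd A_dec i.
  - exact: eigdec_ge0 B_psd B_dec j.
  - exact: sqmod_ge0.
apply: (@le_trans _ _ (\sum_(i < m) \sum_(j < m) (a i - b j) * w i j)); last first.
  by apply: ler_sum => i _; apply: ler_sum => j _.
have -> : \sum_(i < m) \sum_(j < m) (a i - b j) * w i j =
    \sum_(i < m) \sum_(j < m) a i * w i j - \sum_(i < m) \sum_(j < m) b j * w i j.
  by rewrite -sumrB; apply: eq_bigr => i _; rewrite -sumrB; apply: eq_bigr => j _; rewrite mulrBl.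
rewrite [X in _ - X]exchange_big /=.
have -> : \sum_(i < m) \sum_(j < m) a i * w i j = 1.
  rewrite -A_tr (eigdec_trace A_dec); apply: eq_bigr => i _.
  by rewrite -mulr_sumr overlap_row mulr1.
have -> : \sum_(j < m) \sum_(i < m) b j * w i j = 1.
  rewrite -B_tr (eigdec_trace B_dec); apply: eq_bigr => j _.
  by rewrite -mulr_sumr overlap_col mulr1.
by rewrite subrr.
Qed.

(** The right-hand side is the classical divergence of [p] from [p']. The log-average comparison is
    applied to the weights [a i * w i j] at the ratios [b j / a i], and to the weights [p x] at the
    ratios [p' x / p x]. *)
Lemma relent_le : \sum_x p x = 1 ->
  relent <= - \sum_x (if p x == 0 then 0 else p x * ln (p' x / p x)%R).
Proof.
move=> p1.
have a0 (i : 'I_m) : 0 <= a i := eigdec_ge0 A_psd A_dec i.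
have b0 (i : 'I_m) : 0 <= b i := eigdec_ge0 B_psd B_dec i.
pose wt (k : 'I_m * 'I_m) := a k.1 * w k.1 k.2.
(* At zero weight the ratio is replaced by 1, here and in [q], since the comparison asks for
   positive ratios everywhere. *)
pose r (k : 'I_m * 'I_m) := if wt k == 0 then 1 else b k.2 / a k.1.
pose q x := if p x == 0 then 1 else p' x / p x.
have wt0 k : 0 <= wt k by rewrite mulr_ge0 ?sqmod_ge0.
have wtN k : wt k != 0 -> 0 < a k.1 /\ 0 < b k.2.
  move=> h; split.
    by rewrite lt0r a0 andbT; apply: contraNneq h => e; rewrite /wt e mul0r.
  by rewrite lt0r b0 andbT; apply: contraNneq h => e; rewrite /wt overlap_supp.
have pN x : p x != 0 -> 0 < p x /\ 0 < p' x.
  move=> h; have P : 0 < p x by rewrite lt0r h p_ge0.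
  by split=> //; exact: p_supp.
have H : \sum_x p x * ln (q x) <= \sum_k wt k * ln (r k).
  apply: ln_average_le => //.

  - by move=> k; rewrite /r; case: eqVneq => [_|/wtN[? ?]]; rewrite ?ltr01 ?divr_gt0.
  - by move=> x; rewrite /q; case: eqVneq => [_|/pN[? ?]]; rewrite ?ltr01 ?divr_gt0.
  - rewrite -(pair_bigA _ (fun i j : 'I_m => a i * w i j)) /= -A_tr (eigdec_trace A_dec).
    by apply: eq_bigr => i _; rewrite -mulr_sumr overlap_row mulr1.
  (* As [a^2 / (b + s a) = a / (b / a + s)], the required comparison of resolvent sums is
     [resolvent_mix_le]. *)
  move=> s s0.
  have := resolvent_mix_le Ax_psd Ax_tr p_ge0 p'_ge0 AE BE A_psd B_psd A_dec B_dec s0.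
  rewrite (pair_bigA _ (fun i j : 'I_m => sqmod ((V^t* *m U) j i) * (a i ^+ 2 / (b j + s * a i)))) /=.
  have -> : \sum_x p x ^+ 2 / (p' x + s * p x) = \sum_x p x / (q x + s).
    apply: eq_bigr => x _; rewrite /q; case: eqVneq => [->|/pN[P P']].
      by rewrite expr2 !mul0r.
    have D : 0 < p' x + s * p x by rewrite addr_gt0 ?mulr_gt0.
    have -> : p' x / p x + s = (p' x + s * p x) / p x by field; rewrite gt_eqF.
    by rewrite invf_div mulrA expr2.
  congr (_ <= _); apply: eq_bigr => k _; rewrite -/(w k.1 k.2) /r.
  have -> : w k.1 k.2 * (a k.1 ^+ 2 / (b k.2 + s * a k.1)) =
      wt k * (a k.1 / (b k.2 + s * a k.1)) by rewrite /wt; ring.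
  case: eqVneq => [->|/wtN[P P']]; first by rewrite !mul0r.
  have -> : b k.2 / a k.1 + s = (b k.2 + s * a k.1) / a k.1 by field; rewrite gt_eqF.
  by rewrite invf_div.
rewrite relentE (pair_bigA _ (fun i j : 'I_m => a i * w i j * (ln_supp (a i) - ln_supp (b j)))) /=.
rewrite lerNr -sumrN.
have -> : \sum_(k : 'I_m * 'I_m) - (a k.1 * w k.1 k.2 * (ln_supp (a k.1) - ln_supp (b k.2)))
     = \sum_k wt k * ln (r k).
  apply: eq_bigr => k _; rewrite /r -/(wt k).
  case: eqVneq => [->|/wtN[P P']]; first by rewrite !mul0r oppr0.
  rewrite ln_quot; try exact/RltP.
  rewrite /ln_supp; move: P P' => /RltP P /RltP P'.
  do 2 (case: Rlt_dec => // _); rewrite !RealsE; ring.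
apply: le_trans H; apply: ler_sum => x _; rewrite /q.
by case: eqVneq => // ->; rewrite mul0r.
Qed.
End RelativeEntropy.

End SpectralOverlap.

(** * Transfer to density matrices and mixtures in the concrete encoding *)

Lemma density_psd m rho : is_density m rho ->
  psd (toM m rho) /\ Re (\tr (toM m rho)) = 1.
Proof.
case=> /meqE; rewrite toM_adj => H [P T]; split; last first.
  have -> : 1 = Re (toC Defs.C1) by [].
  rewrite -T toC_sum.
  by congr complex.Re; apply: eq_bigr => i _; rewrite mxE.
split=> // Z; rewrite -mulmxA /mxtrace Re_sum; apply: sumr_ge0 => k _.
(* Column [k] of [Z], extended by zero: the [k]-th diagonal entry of the product is the quadratic
   form of [rho] at this vector. *)
pose v (i : nat) : Defs.C :=
  if insub i is Some i' then mkC (Re (Z i' k)) (Im (Z i' k)) else C0.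
have vE (i : 'I_m) : toC (v i) = Z i k by rewrite /v valK; case: (Z i k).
have := P v; match goal with |- Rle _ ?e -> _ => have -> : e =
    Re (toC (Csum m (fun i => Cmul (Cconj (v i)) (Csum m (fun j => Cmul (rho i j) (v j)))))) by [] end.
move/RleP; congr (_ <= complex.Re _).
rewrite toC_sum mxE; apply: eq_bigr => i _.
rewrite toC_mul toC_conj vE !mxE toC_sum; congr (_ * _).
by apply: eq_bigr => j _; rewrite toC_mul vE mxE.
Qed.

Lemma toM_mix n m rho p :
  toM m (rho_mix n rho p) = \sum_(x < n) (p x)%:C%C *: toM m (rho x).
Proof.
apply/matrixP=> i j; rewrite mxE /rho_mix toC_sum summxE; apply: eq_bigr => x _.
rewrite !mxE; case: (rho x i j) => u v.
by rewrite /toC /Cscale /= ; congr Complex; rewrite /= ?RealsE; ring.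
Qed.

Lemma mix_psd n m rho p : (forall x, lt x n -> is_density m (rho x)) -> simplex n p ->
  psd (toM m (rho_mix n rho p)) /\ Re (\tr (toM m (rho_mix n rho p))) = 1.
Proof.
move=> D [p0 p1].
have D' (x : 'I_n) := density_psd (D _ (elimT ssrnat.ltP (ltn_ord x))).
have Q X Y := @Re_tr_mix m n (fun x => p x) (fun x => toM m (rho x)) X Y.
rewrite toM_mix; split; first split.
- rewrite linear_sum map_mx_sum; apply: eq_bigr => x _ /=.
  have [[h _] _] := D' x.
  rewrite linearZ /= map_mxZ h /=; congr (_ *: _); exact: conjc_real.
- move=> Z; rewrite Q; apply: sumr_ge0 => x _; rewrite mulr_ge0 //.
    by apply/RleP; apply: p0; apply/ssrnat.ltP.
  by have [[_ h] _] := D' x.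
have := Q 1%:M 1%:M; rewrite mulmx1 mul1mx => ->.
rewrite -[RHS]p1 RsumE; apply: eq_bigr => x _.
by rewrite mulmx1 mul1mx; have [_ ->] := D' x; rewrite mulr1.
Qed.

(** Since a diagonalisation exists, [epsilon] returns one, and [mlog] is the logarithm on the
    support taken in that eigenbasis. *)
Lemma mlog_eigdec m sigma : psd (toM m sigma) ->
  exists mu V, eigdec (toM m sigma) mu V /\
    toM m (mlog m sigma) = V *m rdiag m (fun k => ln_supp (mu k)) *m V^t*.
Proof.
case=> /spectral_existence[mu0 [V0 S0]] _; rewrite /mlog.
set pr := epsilon _ _.
have [/meqE S1 /meqE S2] : spectral m sigma (fst pr) (snd pr).
  apply: (epsilon_spec (inhabits _) (fun pr => spectral m sigma (fst pr) (snd pr))).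
  by exists (mu0, V0).
exists (fst pr), (toM m (snd pr)); split; last first.
  by rewrite !toM_mul toM_adj toM_diag.
split; first by rewrite -toM_adj -toM_mul S1 toM_id.
by rewrite S2 !toM_mul toM_adj toM_diag.
Qed.

Lemma trRe_mix n m rho p L :
  trRe m (rho_mix n rho p) L = Rsum n (fun x => Rmult (p x) (trRe m (rho x) L)).
Proof.
rewrite trRe_toM toM_mix RsumE -[X in \tr (X *m _)]mul1mx.
rewrite (@Re_tr_mix m n (fun x => p x) (fun x => toM m (rho x))).
by apply: eq_bigr => x _; rewrite mul1mx trRe_toM.
Qed.

Lemma trRe_msub m A B L : trRe m A (msub B L) = Rminus (trRe m A B) (trRe m A L).
Proof. by rewrite !trRe_toM toM_sub mulmxBr Re_trB. Qed.

Section MixRelativeEntropy.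
Variables (n m : nat) (rho : nat -> Mat) (p p' : nat -> RR).
Hypothesis rho_density : forall x, lt x n -> is_density m (rho x).
Hypothesis p_simplex : simplex n p.
Hypothesis p'_simplex : simplex n p'.
Hypothesis p_supp : forall x, lt x n -> Rlt 0 (p x) -> Rlt 0 (p' x).

Let relent := Rminus (trRe m (rho_mix n rho p) (mlog m (rho_mix n rho p)))
                     (trRe m (rho_mix n rho p) (mlog m (rho_mix n rho p'))).

(** Klein's inequality and joint convexity for the concrete matrices. The explicit [match] has the
    shape of the test in [f_lam], so that the sum can be folded into [neg_kl] later. *)
Lemma mix_relent_bounds : Rle 0 relent /\
  Rle relent (Ropp (Rsum n (fun x =>
    match Rlt_dec (IZR 0) (p x) with
    | left _ => Rmult (p x) (ln (Rdiv (p' x) (p x)))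
    | right _ => IZR 0
    end))).
Proof.
have lt_ord (x : 'I_n) : lt x n by apply/ssrnat.ltP.
have [psdA trA] := mix_psd rho_density p_simplex.
have [psdB trB] := mix_psd rho_density p'_simplex.
have [a [U [dA EA]]] := mlog_eigdec psdA.
have [b [V [dB EB]]] := mlog_eigdec psdB.
have psdx (x : 'I_n) : psd (toM m (rho x))
  by have [] := density_psd (rho_density (lt_ord x)).
have trx (x : 'I_n) : Re (\tr (toM m (rho x))) = 1
  by have [] := density_psd (rho_density (lt_ord x)).
have p0 (x : 'I_n) : 0 <= p x by apply/RleP; apply: p_simplex.1.
have p'0 (x : 'I_n) : 0 <= p' x by apply/RleP; apply: p'_simplex.1.
have supp (x : 'I_n) : 0 < p x -> 0 < p' x by move=> /RltP h; apply/RltP; apply: p_supp.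
rewrite /relent !trRe_toM EA EB; split; apply/RleP.
  exact: (@relent_ge0 m n (fun x => p x) (fun x => p' x) _ _ _ U V a b psdx p0 p'0 supp
    (toM_mix _ _ _ _) (toM_mix _ _ _ _) psdA psdB trA trB dA dB).
apply: (le_trans (@relent_le m n (fun x => p x) (fun x => p' x) _ _ _ U V a b psdx trx p0 p'0 supp
    (toM_mix _ _ _ _) (toM_mix _ _ _ _) psdA psdB trA dA dB _)).
  by rewrite -[RHS]p_simplex.2 RsumE.
rewrite RsumE RoppE lerN2; apply: ler_sum => x _.
case: Rlt_dec => h /=; first by move/RltP: h => h; rewrite gt_eqF // lexx.
case: eqVneq => // h'; case: h; apply/RltP; by rewrite lt0r h' p0.
Qed.
End MixRelativeEntropy.

End Quantum.

(** * Convergence of the iteration *)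

Lemma Rsum_ext (n : nat) (f g : nat -> R) :
  (forall x, (x < n)%nat -> f x = g x) -> Rsum n f = Rsum n g.
Proof.
  induction n as [|n IH]; intros h; simpl; [reflexivity|].
  rewrite IH, h; [reflexivity | lia | intros; apply h; lia].
Qed.

Lemma Rsum_le (n : nat) (f g : nat -> R) :
  (forall x, (x < n)%nat -> f x <= g x) -> Rsum n f <= Rsum n g.
Proof.
  induction n as [|n IH]; intros h; simpl; [lra|].
  apply Rplus_le_compat; [apply IH; intros; apply h; lia | apply h; lia].
Qed.

Lemma Rsum_plus (n : nat) (f g : nat -> R) :
  Rsum n (fun x => f x + g x) = Rsum n f + Rsum n g.
Proof. induction n as [|n IH]; simpl; [ring | rewrite IH; ring]. Qed.

Lemma Rsum_scal (n : nat) (c : R) (f : nat -> R) :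
  Rsum n (fun x => c * f x) = c * Rsum n f.
Proof. induction n as [|n IH]; simpl; [ring | rewrite IH; ring]. Qed.

Lemma Rsum_minus (n : nat) (f g : nat -> R) :
  Rsum n (fun x => f x - g x) = Rsum n f - Rsum n g.
Proof. induction n as [|n IH]; simpl; [ring | rewrite IH; ring]. Qed.

Lemma Rsum_const (n : nat) (c : R) : Rsum n (fun _ => c) = INR n * c.
Proof.
  induction n as [|n IH]; [simpl; ring|].
  rewrite S_INR. simpl Rsum. rewrite IH. ring.
Qed.

Lemma Rsum_nonneg (n : nat) (f : nat -> R) :
  (forall x, (x < n)%nat -> 0 <= f x) -> 0 <= Rsum n f.
Proof.
  intros h. rewrite <- (Rmult_0_r (INR n)), <- Rsum_const. now apply Rsum_le.
Qed.

Lemma Rsum_term_le (n x : nat) (f : nat -> R) :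
  (forall y, (y < n)%nat -> 0 <= f y) -> (x < n)%nat -> f x <= Rsum n f.
Proof.
  induction n as [|n IH]; intros h hx; [lia|]. simpl.
  destruct (Nat.eq_dec x n) as [->|ne].
  - assert (0 <= Rsum n f) by (apply Rsum_nonneg; intros; apply h; lia). lra.
  - assert (f x <= Rsum n f) by (apply IH; [intros; apply h; lia | lia]).
    assert (0 <= f n) by (apply h; lia). lra.
Qed.

Lemma Rsum_pos (n : nat) (f : nat -> R) :
  (1 <= n)%nat -> (forall x, (x < n)%nat -> 0 < f x) -> 0 < Rsum n f.
Proof.
  intros hn h. apply Rlt_le_trans with (f 0%nat); [apply h; lia|].
  apply Rsum_term_le; [intros; left; now apply h | lia].
Qed.

(** * Limits and compactness in finitely many coordinates *)

Lemma Un_cv_Rsum (n : nat) (u : nat -> nat -> R) (l : nat -> R) :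
  (forall x, (x < n)%nat -> Un_cv (fun k => u k x) (l x)) ->
  Un_cv (fun k => Rsum n (u k)) (Rsum n l).
Proof.
  induction n as [|n IH]; intros h; simpl.
  - intros eps he. exists 0%nat. intros. now rewrite Rdist_eq.
  - apply CV_plus; [apply IH; intros; apply h; lia | apply h; lia].
Qed.

Lemma Un_cv_reindex (u : nat -> R) (l : R) (phi : nat -> nat) :
  (forall k, (k <= phi k)%nat) -> Un_cv u l -> Un_cv (fun k => u (phi k)) l.
Proof.
  intros hphi hu eps he. destruct (hu eps he) as [N hN].
  exists N. intros k hk. apply hN. specialize (hphi k). lia.
Qed.

Lemma Un_cv_inv_S : Un_cv (fun k => / (INR k + 1)) 0.
Proof.
  intros eps he. destruct (archimed_cor1 eps he) as [N [h1 h2]].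
  exists N. intros k hk. unfold Rdist. rewrite Rminus_0_r.
  assert (0 < INR N) by (apply lt_0_INR; lia).
  assert (INR N <= INR k) by (apply le_INR; lia).
  rewrite Rabs_pos_eq by (left; apply Rinv_0_lt_compat; lra).
  apply Rlt_trans with (/ INR N); [apply Rinv_lt_contravar; nra | assumption].
Qed.

Lemma functional_choice (A B : Type) (P : A -> B -> Prop) :
  (forall a, exists b, P a b) -> exists f, forall a, P a (f a).
Proof.
  intros h. exists (fun a => proj1_sig (constructive_indefinite_description _ (h a))).
  intros a. apply proj2_sig.
Qed.

(** Induction on the number of coordinates: a reindexing good for the first [n] is thinned out by
    compactness of the unit interval in the last one. The condition [k <= phi k] suffices to
    preserve limits and is stable under composition. *)
Lemma bolzano_weierstrass_coordinates (n : nat) (u : nat -> nat -> R) :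
  (forall k x, (x < n)%nat -> 0 <= u k x <= 1) ->
  exists (phi : nat -> nat) (l : nat -> R), (forall k, (k <= phi k)%nat) /\
    forall x, (x < n)%nat -> Un_cv (fun k => u (phi k) x) (l x).
Proof.
  induction n as [|n IH]; intros h.
  - exists (fun k => k), (fun _ => 0). split; intros; lia.
  - destruct IH as [phi [l [hphi hl]]]; [intros; apply h; lia|].
    destruct (Bolzano_Weierstrass (fun k => u (phi k) n) (fun c => 0 <= c <= 1))
      as [a ha]; [apply compact_P3 | intros; apply h; lia |].
    assert (hpsi : forall k, exists j, (k <= j)%nat /\ Rabs (u (phi j) n - a) < / (INR k + 1)).
    { intros k. assert (pk : 0 < / (INR k + 1)).
      { apply Rinv_0_lt_compat. pose proof (pos_INR k). lra. }
      destruct (ha (disc a (mkposreal _ pk)) k) as [j [hj1 hj2]].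
      - now exists (mkposreal _ pk).
      - exists j. now split. }
    destruct (functional_choice _ _ _ hpsi) as [psi hp].
    exists (fun k => phi (psi k)), (fun x => if Nat.eq_dec x n then a else l x). split.
    + intros k. specialize (hphi (psi k)). destruct (hp k). lia.
    + intros x hx. destruct (Nat.eq_dec x n) as [->|ne].
      * intros eps he. destruct (Un_cv_inv_S eps he) as [N hN].
        exists N. intros k hk. specialize (hN k hk). destruct (hp k) as [_ hk2].
        unfold Rdist in *. rewrite Rminus_0_r in hN.
        pose proof (Rle_abs (/ (INR k + 1))). lra.
      * apply (Un_cv_reindex (fun k => u (phi k) x)); [intros k; apply hp | apply hl; lia].
Qed.

Lemma simplex_le_1 (n : nat) (p : nat -> R) (x : nat) :
  simplex n p -> (x < n)%nat -> p x <= 1.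
Proof. intros [h1 h2] hx. rewrite <- h2. now apply Rsum_term_le. Qed.

(** * The objective, its bounds and its maximum *)

Section BlahutArimoto.
Variables (n m : nat) (rho : nat -> Mat) (s : nat -> R) (lam : R).
Hypothesis n_pos : (1 <= n)%nat.
Hypothesis rho_density : forall x, (x < n)%nat -> is_density m (rho x).

(** The amount added to [ln (q x)] in the exponent of the update, and also the coefficient of [p x]
    in the linear part of the objective. *)
Let reward (q : nat -> R) (x : nat) : R :=
  trRe m (rho x) (mlog m (rho x)) - trRe m (rho x) (mlog m (rho_mix n rho q)) - lam * s x.
Let linear_part (p q : nat -> R) : R := Rsum n (fun x => p x * reward q x).
Let neg_kl (p q : nat -> R) : R :=
  Rsum n (fun x => if Rlt_dec 0 (p x) then p x * ln (q x / p x) else 0).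
(** The objective on the diagonal: the Holevo quantity of the ensemble minus the cost term. *)
Let holevo (p : nat -> R) : R := linear_part p p.

(** Donald's identity: the self-entropy terms of the states and the costs cancel, leaving the
    relative entropy of the two mixtures. *)
Lemma linear_part_minus_holevo (p q : nat -> R) :
  linear_part p q - holevo p =
  trRe m (rho_mix n rho p) (mlog m (rho_mix n rho p))
  - trRe m (rho_mix n rho p) (mlog m (rho_mix n rho q)).
Proof.
  rewrite !Quantum.trRe_mix. unfold holevo, linear_part.
  rewrite <- !Rsum_minus. apply Rsum_ext. intros x _. unfold reward. ring.
Qed.

(** The lower bound is joint convexity and says that [q = p] is the best second argument; the upper
    bound is Klein's inequality. *)
Lemma holevo_bounds (p q : nat -> R) : simplex n p -> simplex n q ->
  (forall x, (x < n)%nat -> 0 < p x -> 0 < q x) ->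
  neg_kl p q + linear_part p q <= holevo p <= linear_part p q.
Proof.
  intros hp hq h.
  pose proof (Quantum.mix_relent_bounds rho_density hp hq h) as [h1 h2].
  rewrite <- linear_part_minus_holevo in h1, h2.
  fold (neg_kl p q) in h2. lra.
Qed.

Lemma neg_kl_self (p : nat -> R) : neg_kl p p = 0.
Proof.
  transitivity (Rsum n (fun _ => 0)); [apply Rsum_ext | rewrite Rsum_const; ring].
  intros x _. destruct (Rlt_dec 0 (p x)); [|reflexivity].
  rewrite Rdiv_diag by lra. rewrite ln_1. ring.
Qed.

Lemma f_lam_sum (p q : nat -> R) : simplex n p ->
  Rsum n (fun x => if Rlt_dec 0 (p x) then
             p x * ln (q x / p x)
             + p x * trRe m (rho x) (msub (mlog m (rho x)) (mlog m (rho_mix n rho q)))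
           else 0) - lam * Rsum n (fun x => s x * p x)
  = neg_kl p q + linear_part p q.
Proof.
  intros [hp _]. unfold neg_kl, linear_part.
  rewrite <- Rsum_scal, <- Rsum_plus, <- Rsum_minus.
  apply Rsum_ext. intros x hx. specialize (hp x hx).
  rewrite Quantum.trRe_msub. unfold reward.
  destruct (Rlt_dec 0 (p x)); [ring|]. replace (p x) with 0 by lra. ring.
Qed.

Lemma f_lam_Some (p q : nat -> R) : simplex n p ->
  (forall x, (x < n)%nat -> 0 < p x -> 0 < q x) ->
  f_lam n m rho s lam p q = Some (neg_kl p q + linear_part p q).
Proof.
  intros hp h. unfold f_lam. destruct excluded_middle_informative as [[x [h1 [h2 h3]]]|_].
  - specialize (h x h1 h2). lra.
  - now rewrite f_lam_sum.
Qed.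

Lemma f_lam_inv (p q : nat -> R) (v : R) : simplex n p -> simplex n q ->
  f_lam n m rho s lam p q = Some v ->
  (forall x, (x < n)%nat -> 0 < p x -> 0 < q x) /\ v = neg_kl p q + linear_part p q.
Proof.
  intros hp [hq _]. unfold f_lam. destruct excluded_middle_informative as [_|h]; [discriminate|].
  rewrite f_lam_sum by assumption. intros E. injection E as <-. split; [|reflexivity].
  intros x h1 h2. destruct (hq x h1) as [|e]; [assumption|].
  exfalso. apply h. exists x. auto.
Qed.

Lemma uniform_simplex : simplex n (fun _ => 1 / INR n).
Proof.
  assert (0 < INR n) by (apply lt_0_INR; lia). split.
  - intros x _. apply Rlt_le, Rdiv_lt_0_compat; lra.
  - rewrite Rsum_const. field. lra.
Qed.

(* Upper semicontinuity: [holevo p <= linear_part p q] is linear in [p], and for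
   [q] a slight perturbation of [p] the gap is at most [-ln(1-e)]. *)
Lemma holevo_attains_max :
  exists p, simplex n p /\ forall q, simplex n q -> holevo q <= holevo p.
Proof.
  assert (hn : 0 < INR n) by (apply lt_0_INR; lia).
  set (u := fun _ : nat => 1 / INR n).
  assert (hu : 0 < 1 / INR n) by (apply Rdiv_lt_0_compat; lra).
  destruct (completeness (fun y => exists p, simplex n p /\ y = holevo p)) as [B [hB1 hB2]].
  - exists (Rsum n (fun x => Rabs (reward u x))). intros y [p [hp ->]].
    apply Rle_trans with (linear_part p u).
    + apply holevo_bounds; [assumption | apply uniform_simplex | intros; apply hu].
    + apply Rsum_le. intros x hx.
      pose proof (simplex_le_1 n p x hp hx). destruct hp as [hp _]. specialize (hp x hx).
      pose proof (Rle_abs (reward u x)). pose proof (Rabs_pos (reward u x)). nra.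
  - exists (holevo u), u. split; [apply uniform_simplex | reflexivity].
  (* A maximising sequence for the supremum [B]; its coordinatewise limit point [l] will be the
     maximiser. *)
  - assert (hseq : forall k : nat, exists p, simplex n p /\ B - / (INR k + 1) < holevo p).
    { intros k. apply NNPP. intros hno.
      assert (pk : 0 < / (INR k + 1)).
      { apply Rinv_0_lt_compat. pose proof (pos_INR k). lra. }
      assert (B <= B - / (INR k + 1)); [|lra].
      apply hB2. intros y [p [hp ->]]. apply Rnot_lt_le. intros hlt.
      apply hno. now exists p. }
    destruct (functional_choice _ _ _ hseq) as [w hw].
    destruct (bolzano_weierstrass_coordinates n w) as [phi [l [hphi hl]]].
    { intros k x hx. destruct (hw k) as [hk _].
      split; [now apply hk | now apply (simplex_le_1 n)]. }
    assert (l_simplex : simplex n l).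
    { split.
      - intros x hx. apply Rnot_lt_le. intros neg.
        destruct (hl x hx (- l x)) as [N hN]; [lra|].
        specialize (hN N (le_n N)). apply Rabs_def2 in hN.
        destruct (hw (phi N)) as [[hk _] _]. specialize (hk x hx). lra.
      - apply (UL_sequence (fun k => Rsum n (w (phi k)))).
        + now apply Un_cv_Rsum.
        + intros eps he. exists 0%nat. intros k _.
          destruct (hw (phi k)) as [[_ ->] _]. now rewrite Rdist_eq. }
    (* For fixed [q] of full support the upper bound is linear in [p], so it passes to the limit
       along the maximising sequence. *)
    assert (hlin : forall q, simplex n q -> (forall x, (x < n)%nat -> 0 < q x) ->
              B <= linear_part l q).
    { intros q hq qpos. apply Rnot_lt_le. intros hlt.
      set (d := (B - linear_part l q) / 2). assert (hd : 0 < d) by (unfold d; lra).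
      assert (cv : Un_cv (fun k => linear_part (w (phi k)) q) (linear_part l q)).
      { apply (Un_cv_Rsum n (fun k x => w (phi k) x * reward q x)).
        intros x hx. apply CV_mult; [now apply hl|].
        intros eps he. exists 0%nat. intros. now rewrite Rdist_eq. }
      destruct (cv d hd) as [N1 h1].
      destruct (Un_cv_reindex _ _ phi hphi Un_cv_inv_S d hd) as [N2 h2].
      specialize (h1 (N1 + N2)%nat ltac:(lia)). specialize (h2 (N1 + N2)%nat ltac:(lia)).
      set (k := phi (N1 + N2)%nat) in *. apply Rabs_def2 in h1, h2.
      destruct (hw k) as [hk1 hk2].
      destruct (holevo_bounds (w k) q hk1 hq ltac:(auto)) as [_ hk3].
      unfold d in *. lra. }
    exists l. split; [assumption|]. intros q hq.
    apply Rle_trans with B; [apply hB1; now exists q|].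
    apply Rnot_lt_le. intros hlt.
    set (d := (B - holevo l) / 2). assert (hd : 0 < d) by (unfold d; lra).
    (* Mixing [l] with the uniform distribution gives a positive [r >= c * l], so the divergence of
       [l] from [r] is at most [d]. Then [B - d <= holevo l = B - 2 d], a contradiction. *)
    set (c := exp (- d)). assert (c0 : 0 < c) by apply exp_pos.
    assert (c1 : c < 1) by (rewrite <- exp_0; apply exp_increasing; lra).
    set (r := fun x => c * l x + (1 - c) * (1 / INR n)).
    assert (r_pos : forall x, (x < n)%nat -> 0 < r x).
    { intros x hx. destruct l_simplex as [h _]. specialize (h x hx). unfold r. nra. }
    assert (r_simplex : simplex n r).
    { split; [intros; left; auto|]. unfold r.
      rewrite Rsum_plus, Rsum_scal, Rsum_const. destruct l_simplex as [_ ->]. field. lra. }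
    assert (kl : - d <= neg_kl l r).
    { replace (- d) with (Rsum n (fun x => - d * l x))
        by (rewrite Rsum_scal; destruct l_simplex as [_ ->]; ring).
      apply Rsum_le. intros x hx. destruct (Rlt_dec 0 (l x)) as [hx'|hx'].
      - assert (c <= r x / l x).
        { apply Rmult_le_reg_r with (l x); [assumption|]. unfold Rdiv.
          rewrite Rmult_assoc, Rinv_l by lra. unfold r. nra. }
        assert (- d <= ln (r x / l x)).
        { rewrite <- (ln_exp (- d)). now apply ln_mono. }
        nra.
      - destruct l_simplex as [h _]. specialize (h x hx). nra. }
    destruct (holevo_bounds l r l_simplex r_simplex ltac:(auto)) as [h _].
    specialize (hlin r r_simplex r_pos). unfold d in *. lra.
Qed.

(** Each value of the objective at [p], [q] is at most [holevo p], which is itself the value at [p],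
    [p]. So the maximiser of [holevo] shows the predicate under [epsilon] to be satisfiable. *)
Lemma F_lam_max :
  (exists p, simplex n p /\ F_lam n m rho s lam <= holevo p) /\
  (forall p q v, simplex n p -> simplex n q ->
     f_lam n m rho s lam p q = Some v -> v <= F_lam n m rho s lam).
Proof.
  unfold F_lam. match goal with |- context [epsilon ?i ?P] =>
    assert (hP : P (epsilon i P)) end.
  - apply epsilon_spec. destruct holevo_attains_max as [p [hp hmax]].
    exists (holevo p). split.
    + exists p, p. repeat split; try apply hp.
      rewrite f_lam_Some, neg_kl_self by auto. f_equal. unfold holevo. ring.
    + intros q q' v hq hq' hv. destruct (f_lam_inv _ _ _ hq hq' hv) as [h ->].
      apply Rle_trans with (holevo q); [now apply holevo_bounds | auto].
  - destruct hP as [[p [q [hp [hq hv]]]] hmax]. split; [|assumption].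
    exists p. split; [assumption|].
    destruct (f_lam_inv _ _ _ hp hq hv) as [h ->]. now apply holevo_bounds.
Qed.

(** * The update step and Gibbs' inequality *)

Let weight (q : nat -> R) (x : nat) : R := exp (ln (q x) + reward q x).
Let normalizer (q : nat -> R) : R := Rsum n (weight q).

Lemma normalizer_pos (q : nat -> R) : 0 < normalizer q.
Proof. apply Rsum_pos; [assumption | intros; apply exp_pos]. Qed.

Lemma BA_step_weight (q : nat -> R) (x : nat) :
  BA_step n m rho s lam q x = weight q x / normalizer q.
Proof.
  unfold BA_step, normalizer.
  assert (E : forall y, exp (ln (q y) + trRe m (rho y) (mlog m (rho y))
      - trRe m (rho y) (mlog m (rho_mix n rho q)) - lam * s y) = weight q y).
  { intros y. unfold weight, reward. f_equal. ring. }
  rewrite E. f_equal. apply Rsum_ext. intros y _. apply E.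
Qed.

Lemma BA_step_pos (q : nat -> R) (x : nat) : 0 < BA_step n m rho s lam q x.
Proof.
  rewrite BA_step_weight. apply Rdiv_lt_0_compat; [apply exp_pos | apply normalizer_pos].
Qed.

Lemma BA_step_simplex (q : nat -> R) : simplex n (BA_step n m rho s lam q).
Proof.
  split; [intros; left; apply BA_step_pos|].
  rewrite (Rsum_ext _ _ (fun x => / normalizer q * weight q x)).
  - rewrite Rsum_scal. apply Rinv_l, Rgt_not_eq, normalizer_pos.
  - intros x _. rewrite BA_step_weight. unfold Rdiv. ring.
Qed.

Lemma BA_pos (t x : nat) : 0 < BA n m rho s lam t x.
Proof.
  destruct t; [|apply BA_step_pos]. simpl. apply Rdiv_lt_0_compat; [lra|]. apply lt_0_INR. lia.
Qed.

Lemma BA_simplex (t : nat) : simplex n (BA n m rho s lam t).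
Proof. destruct t; [apply uniform_simplex | apply BA_step_simplex]. Qed.

(** In logarithms the update is additive, which is the source of the telescoping. *)
Lemma ln_BA_step (q : nat -> R) (x : nat) :
  ln (BA_step n m rho s lam q x) = ln (q x) + reward q x - ln (normalizer q).
Proof.
  rewrite BA_step_weight, ln_quot; [|apply exp_pos|apply normalizer_pos].
  unfold weight. now rewrite ln_exp.
Qed.

(* Gibbs' inequality against the distribution [BA_step q]. *)
Lemma objective_le_ln_normalizer (p q : nat -> R) : simplex n p ->
  (forall x, (x < n)%nat -> 0 < q x) ->
  neg_kl p q + linear_part p q <= ln (normalizer q).
Proof.
  intros hp hq.
  (* Termwise this is [p ln (b / p) <= b - p] with [b] the updated distribution; the right-hand side
     sums to 0 as both are probability vectors. *)
  assert (h : Rsum n (fun x => (if Rlt_dec 0 (p x) then p x * ln (q x / p x) else 0)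
      + p x * reward q x - ln (normalizer q) * p x)
    <= Rsum n (fun x => BA_step n m rho s lam q x - p x)).
  { apply Rsum_le. intros x hx. specialize (hq x hx).
    pose proof (BA_step_pos q x) as hb. pose proof (ln_BA_step q x) as hln.
    set (b := BA_step n m rho s lam q x) in *.
    destruct (Rlt_dec 0 (p x)) as [px|px].
    - assert (0 < b / p x) by now apply Rdiv_lt_0_compat.
      pose proof (ln_le_pred (b / p x) ltac:(assumption)) as hl.
      rewrite ln_quot in hl |- * by assumption.
      assert (p x * (ln b - ln (p x)) <= p x * (b / p x - 1)) by (apply Rmult_le_compat_l; lra).
      replace (p x * (b / p x - 1)) with (b - p x) in * by (field; lra).
      nra.
    - destruct hp as [hp _]. specialize (hp x hx). replace (p x) with 0 by lra. lra. }
  rewrite !Rsum_minus, Rsum_plus, Rsum_scal in h.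
  destruct (BA_step_simplex q) as [_ e]. rewrite e in h. destruct hp as [_ hp]. rewrite hp in h.
  unfold neg_kl, linear_part. lra.
Qed.

(** The equality case of Gibbs' inequality: every summand equals [ln (normalizer q)] times the
    updated probability. *)
Lemma objective_BA_step (q : nat -> R) : (forall x, (x < n)%nat -> 0 < q x) ->
  neg_kl (BA_step n m rho s lam q) q + linear_part (BA_step n m rho s lam q) q
  = ln (normalizer q).
Proof.
  intros hq. unfold neg_kl, linear_part. rewrite <- Rsum_plus.
  rewrite (Rsum_ext _ _ (fun x => ln (normalizer q) * BA_step n m rho s lam q x)).
  - rewrite Rsum_scal. destruct (BA_step_simplex q) as [_ ->]. ring.
  - intros x hx. pose proof (BA_step_pos q x) as hb.
    destruct (Rlt_dec 0 _) as [_|]; [|lra].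
    rewrite ln_quot, ln_BA_step by auto. ring.
Qed.

(** * Monotone scores, telescoping and the rate *)

Let score (t : nat) : R := ln (normalizer (BA n m rho s lam t)).

Lemma f_lam_BA (t : nat) :
  f_lam n m rho s lam (BA n m rho s lam (S t)) (BA n m rho s lam t) = Some (score t).
Proof.
  rewrite f_lam_Some; [|apply BA_simplex | intros; apply BA_pos].
  unfold score. rewrite <- objective_BA_step by (intros; apply BA_pos). reflexivity.
Qed.

(** Alternating maximisation: replacing the second argument by [BA (S t)] raises the objective to
    the diagonal value, and the next update of the first argument raises it again. *)
Lemma score_mono (t : nat) : score t <= score (S t).
Proof.
  unfold score at 1. rewrite <- objective_BA_step by (intros; apply BA_pos).
  change (BA_step n m rho s lam (BA n m rho s lam t)) with (BA n m rho s lam (S t)).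
  apply Rle_trans with (holevo (BA n m rho s lam (S t))).
  - apply holevo_bounds; [apply BA_simplex | apply BA_simplex | intros; apply BA_pos].
  - apply Rle_trans with
      (neg_kl (BA n m rho s lam (S t)) (BA n m rho s lam (S t)) + holevo (BA n m rho s lam (S t))).
    + rewrite neg_kl_self. lra.
    + apply objective_le_ln_normalizer; [apply BA_simplex | intros; apply BA_pos].
Qed.

(** By the logarithmic form of the update the right-hand side is [linear_part p (BA t) - score t],
    and Klein's inequality bounds [holevo p] by this linear part. *)
Lemma holevo_gap_le (p : nat -> R) (t : nat) : simplex n p ->
  holevo p - score t <=
  Rsum n (fun x => p x * (ln (BA n m rho s lam (S t) x) - ln (BA n m rho s lam t x))).
Proof.
  intros hp.
  rewrite (Rsum_ext _ _ (fun x => p x * reward (BA n m rho s lam t) x - score t * p x)).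
  - rewrite Rsum_minus, Rsum_scal. destruct hp as [hp0 hp1]. rewrite hp1.
    assert (holevo p <= linear_part p (BA n m rho s lam t)).
    { apply holevo_bounds; [now split | apply BA_simplex | intros; apply BA_pos]. }
    unfold linear_part in *. lra.
  - intros x hx. simpl BA. rewrite ln_BA_step. unfold score. ring.
Qed.

Lemma holevo_gap_telescope (p : nat -> R) (t : nat) : simplex n p ->
  INR (S t) * (holevo p - score t) <=
  Rsum n (fun x => p x * (ln (BA n m rho s lam (S t) x) - ln (1 / INR n))).
Proof.
  intros hp. induction t as [|t IH].
  - simpl INR. rewrite Rmult_1_l. now apply holevo_gap_le.
  - pose proof (holevo_gap_le p (S t) hp) as h.
    rewrite (Rsum_ext _ _ (fun x =>
      p x * (ln (BA n m rho s lam (S t) x) - ln (1 / INR n)) +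
      p x * (ln (BA n m rho s lam (S (S t)) x) - ln (BA n m rho s lam (S t) x))))
      by (intros; ring).
    rewrite Rsum_plus, (S_INR (S t)).
    (* Monotonicity lets the [t + 1] earlier gaps be replaced by the smaller gap at [S t]. *)
    pose proof (score_mono t). pose proof (pos_INR (S t)). nra.
Qed.

Lemma score_rate (t : nat) :
  0 <= F_lam n m rho s lam - score t /\
  INR (S t) * (F_lam n m rho s lam - score t) <= ln (INR n).
Proof.
  destruct F_lam_max as [[p [hp hF]] hmax]. split.
  - assert (score t <= F_lam n m rho s lam); [|lra].
    apply (hmax _ _ _ (BA_simplex (S t)) (BA_simplex t)). apply f_lam_BA.
  - assert (hn : 0 < INR n) by (apply lt_0_INR; lia).
    apply Rle_trans with (INR (S t) * (holevo p - score t)).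
    { apply Rmult_le_compat_l; [apply pos_INR | lra]. }
    eapply Rle_trans; [now apply holevo_gap_telescope|].
    replace (ln (INR n)) with (Rsum n (fun x => ln (INR n) * p x))
      by (rewrite Rsum_scal; destruct hp as [_ ->]; ring).
    (* Each iterate has entries at most 1, so its logarithms are dropped, and [- ln (1 / n) = ln n]
       remains. *)
    apply Rsum_le. intros x hx. rewrite (ln_quot 1), ln_1 by lra.
    assert (ln (BA n m rho s lam (S t) x) <= 0).
    { rewrite <- ln_1. apply ln_mono; [apply BA_pos|].
      apply (simplex_le_1 n); [apply BA_simplex | assumption]. }
    destruct hp as [hp _]. specialize (hp x hx). nra.
Qed.

End BlahutArimoto.

Theorem theorem4 (n m : nat) (rho : nat -> Mat) (s : nat -> R) (lam : R) :
  (2 <= n)%nat -> (1 <= m)%nat ->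
  (forall x, (x < n)%nat -> is_density m (rho x)) ->
  (forall x, (x < n)%nat -> 0 <= s x) ->
  0 <= lam ->
  (forall t : nat, (1 <= t)%nat ->
     exists v, f_lam n m rho s lam (BA n m rho s lam (S t)) (BA n m rho s lam t) = Some v
       /\ 0 <= F_lam n m rho s lam - v
       /\ F_lam n m rho s lam - v < ln (INR n) / INR t) /\
  (forall eps : R, 0 < eps -> forall t : nat, (1 <= t)%nat -> ln (INR n) / eps <= INR t ->
     exists v, f_lam n m rho s lam (BA n m rho s lam (S t)) (BA n m rho s lam t) = Some v
       /\ F_lam n m rho s lam - v < eps).
Proof.
  intros hn _ hrho _ _. assert (hn1 : (1 <= n)%nat) by lia.
  assert (main : forall t : nat, (1 <= t)%nat ->
     exists v, f_lam n m rho s lam (BA n m rho s lam (S t)) (BA n m rho s lam t) = Some v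
       /\ 0 <= F_lam n m rho s lam - v
       /\ F_lam n m rho s lam - v < ln (INR n) / INR t).
  { intros t ht. eexists. split; [now apply f_lam_BA|].
    destruct (score_rate n m rho s lam hn1 hrho t) as [h1 h2]. split; [exact h1|].
    assert (0 < INR t) by (apply lt_0_INR; lia).
    assert (0 < ln (INR n)).
    { rewrite <- ln_1. apply ln_increasing; [lra|]. apply (lt_INR 1). lia. }
    apply Rmult_lt_reg_l with (INR t); [assumption|].
    replace (INR t * (ln (INR n) / INR t)) with (ln (INR n)) by (field; lra).
    (* Strictness: a positive gap gains from the factor [t + 1] in place of [t], while a zero gap
       lies below [ln n], positive since [n >= 2]. *)
    rewrite S_INR in h2. destruct h1 as [h1|h1]; nra. }
  split; [exact main|].
  intros eps he t ht hle. destruct (main t ht) as [v [h1 [_ h2]]].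
  exists v. split; [exact h1|].
  apply Rlt_le_trans with (1 := h2).
  assert (0 < INR t) by (apply lt_0_INR; lia).
  apply Rmult_le_reg_l with (INR t / eps); [now apply Rdiv_lt_0_compat|].
  replace (INR t / eps * (ln (INR n) / INR t)) with (ln (INR n) / eps) by (field; lra).
  replace (INR t / eps * eps) with (INR t) by (field; lra). exact hle.
Qed.
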